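(* Let $(\rho,\phi)\in(0,1)\times(0,1]$. Denote the asymptotic cumulative average profit per game played by $\mu_{\overline B}$ in the situation where game $B$ is eventually played forever, by $\mu_{[1,n]}$ in the case of a limit cycle of the form $[1,n]$ for even $n\ge2$, and by $\mu_{[1,n,1,n-2]}$ in the case of a limit cycle of the form $[1,n,1,n-2]$ for even $n\ge4$. Then all (Cesàro) limits exist, and $\mu_{\overline B}=0$, $\mu_{[1,n]}>0$, and $\mu_{[1,n,1,n-2]}>0$.
   Context: Fix $\rho\in(0,1)$ and $\phi\in(0,1]$. Put $p_0:=\rho^2/(1+\rho^2)$, $p_1:=1/(1+\rho)$, $$\boldsymbol P_B^\circ:=\begin{pmatrix}0&p_0&1-p_0\\ 1-p_1&0&p_1\\ p_1&1-p_1&0\end{pmatrix},\qquad \boldsymbol P_A^\circ:=\begin{pmatrix}0&1/2&1/2\\ 1/2&0&1/2\\ 1/2&1/2&0\end{pmatrix},$$ $\boldsymbol P_A:=(1-\phi)\boldsymbol I+\phi\boldsymbol P_A^\circ$, $\boldsymbol P_B:=(1-\phi)\boldsymbol I+\phi\boldsymbol P_B^\circ$, and $\pi_0:=\frac{1+\rho^2}{2(1+\rho+\rho^2)}$ (first coordinate of the stationary distribution of $\boldsymbol P_B$). Let $\Delta:=\{(x_0,x_1,x_2):x_i\ge0,\ x_0+x_1+x_2=1\}$ (row vectors), $\Delta_A:=\{x\in\Delta:x_0\ge\pi_0\}$, $\Delta_B:=\Delta-\Delta_A$. The greedy strategy is the discrete dynamical system $x(k+1)=F(x(k))$, where $F(x):=x\boldsymbol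 P_A$ if $x\in\Delta_A$ (game $A$ is played) and $F(x):=x\boldsymbol P_B$ if $x\in\Delta_B$ (game $B$ is played). Profit: let $\boldsymbol\zeta:=(2p_0-1,2p_1-1,2p_1-1)^{T}$. The average profit at turn $k$ (from state $x(k)$) is $0$ if game $A$ is played ($x(k)\in\Delta_A$) and $\phi\,x(k)\boldsymbol\zeta$ if game $B$ is played ($x(k)\in\Delta_B$), a fraction $\phi$ of the players taking part in each turn. The asymptotic cumulative average profit per game played along a trajectory is the Cesàro limit, as $N\to\infty$, of $\frac1N\sum_{k=0}^{N-1}(\text{average profit at turn }k)$. ''Game $B$ is eventually played forever'' means $x(k)\in\Delta_B$ for all large $k$. A limit cycle of the form $[1,n]$ is a periodic orbit of $F$ along which the games played are $AB^n$ repeated forever; it passes through $\boldsymbol\pi_{[1,n]}\in\Delta_A$, the stationary distribution of $\boldsymbol P_A\boldsymbol P_B^n$. A limit cycle of the form $[1,n,1,n-2]$ is a periodic orbit of $F$ along which the games played are $AB^nAB^{n-2}$ repeated forever; it passes through $\boldsymbol\pi_{[1,n,1,n-2]}\in\Delta_A$, the stationary distribution of $\boldsymbol P_A\boldsymbol P_B^n\boldsymbol P_A\boldsymbol P_B^{n-2}$. ''In the case of a limit cycle'' of a given form means that such a limit cycle exists and the trajectory considered is one whose game sequence is eventually that periodic pattern (so that the trajectory approaches the cycle). *)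

(* Defs.v *)
From mathcomp Require Import all_boot all_order all_algebra.
From mathcomp Require Import all_classical all_reals all_analysis.

Set Implicit Arguments.
Unset Strict Implicit.
Unset Printing Implicit Defensive.

Import Order.TTheory GRing.Theory Num.Theory.
Import numFieldNormedType.Exports.
Local Open Scope classical_set_scope.
Local Open Scope ring_scope.

Inductive game := GameA | GameB.

Section ParrondoGreedy.
Context {R : realType}.
Variables rho phi : R.

Definition p0 : R := rho ^+ 2 / (1 + rho ^+ 2).
Definition p1 : R := (1 + rho)^-1.

Definition PB0 : 'M[R]_3 := \matrix_(i, j)
  (nth [::] [:: [::      0;      p0; 1 - p0];
                [:: 1 - p1;       0;     p1];
                [::     p1;  1 - p1;      0]] i)`_j.

Definition PA0 : 'M[R]_3 := \matrix_(i, j)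
  (nth [::] [:: [::    0; 2^-1; 2^-1];
                [:: 2^-1;    0; 2^-1];
                [:: 2^-1; 2^-1;    0]] i)`_j.

Definition PA : 'M[R]_3 := (1 - phi)%:M + phi *: PA0.
Definition PB : 'M[R]_3 := (1 - phi)%:M + phi *: PB0.

Definition game_mx (g : game) : 'M[R]_3 :=
  match g with GameA => PA | GameB => PB end.

Definition pi0 : R := (1 + rho ^+ 2) / (2 * (1 + rho + rho ^+ 2)).

Definition Delta : set 'rV[R]_3 :=
  [set x | (forall i, 0 <= x 0 i) /\ \sum_i x 0 i = 1].
Definition DeltaA : set 'rV[R]_3 := Delta `&` [set x | pi0 <= x 0 0].
Definition DeltaB : set 'rV[R]_3 := Delta `\` DeltaA.

(* Only meaningful on Delta, which F maps to itself; states outside Delta get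
   the junk value GameB. *)
Definition game_played (x : 'rV[R]_3) : game :=
  if x \in DeltaA then GameA else GameB.

Definition F (x : 'rV[R]_3) : 'rV[R]_3 := x *m game_mx (game_played x).

Definition trajectory (x : 'rV[R]_3) (k : nat) : 'rV[R]_3 := iter k F x.

Definition zeta : 'cV[R]_3 :=
  \col_i [:: 2 * p0 - 1; 2 * p1 - 1; 2 * p1 - 1]`_i.

Definition profit (x : 'rV[R]_3) : R :=
  match game_played x with
  | GameA => 0
  | GameB => phi * (x *m zeta) 0 0
  end.

(* [arithmetic_mean u n] averages the first n.+1 terms of u, so this is the
   limit as N = n.+1 tends to infinity of N^-1 * \sum_(0 <= k < N) _. *)
Definition asymptotic_profit (x : 'rV[R]_3) (mu : R) : Prop :=
  arithmetic_mean (fun k => profit (trajectory x k)) @ \oo --> mu.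

Definition B_eventually_forever (x : 'rV[R]_3) : Prop :=
  \forall k \near \oo, DeltaB (trajectory x k).

Definition stationary_distribution (P : 'M[R]_3) (y : 'rV[R]_3) : Prop :=
  Delta y /\ y *m P = y.

(* From x on, the games played are the (nonempty) word w repeated forever. *)
Definition plays_periodically (w : seq game) (x : 'rV[R]_3) : Prop :=
  forall k, game_played (trajectory x k) = nth GameA w (k %% size w).

Definition plays_eventually_periodically (w : seq game) (x : 'rV[R]_3) : Prop :=
  exists K, plays_periodically w (trajectory x K).

(* The product runs from left to right along w, since states are row vectors
   multiplied on the right. *)
Definition limit_cycle_through (w : seq game) (y : 'rV[R]_3) : Prop :=
  [/\ stationary_distribution (\prod_(g <- w) game_mx g) y,
      DeltaA y,
      trajectory y (size w) = y
    & plays_periodically w y].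

Definition has_limit_cycle (w : seq game) : Prop :=
  exists y, limit_cycle_through w y.

End ParrondoGreedy.

Definition word1 (n : nat) : seq game := GameA :: nseq n GameB.

Definition word2 (n : nat) : seq game := word1 n ++ word1 (n - 2).

(* Main.v *)
(** On [Delta] the expected one-turn gain of game B is a positive multiple of
    [pi0 - x0], so the greedy strategy never has a negative profit and has a
    positive one whenever B is played.  Along a limit cycle the profit is
    periodic, hence its mean exists and is positive.  On vectors of zero sum
    [PA] acts as the scalar [1 - 3 phi / 2], of modulus less than 1, while
    powers of [PB] map [Delta] to itself; so two trajectories playing the same
    periodic word containing A approach each other geometrically and have the
    same mean profit.  When B is played forever, a solution of the Poisson
    equation [(PB0 - 1) h = zeta] turns the cumulative profit into a bounded
    telescoping sum. *)
Require Import Defs.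
From mathcomp Require Import all_boot all_order all_algebra.
From mathcomp Require Import all_classical all_reals all_analysis.
From mathcomp Require Import ring lra.
Import Order.TTheory GRing.Theory Num.Theory.
Import numFieldNormedType.Exports.
Local Open Scope classical_set_scope.
Local Open Scope ring_scope.

(** * Cesàro means of sequences with bounded discrepancy *)

Definition bounded_discrepancy {R : realType} (u : nat -> R) (mu : R) : Prop :=
  exists C : R, forall N, `|\sum_(k < N) (u k - mu)| <= C.

(** The error of the mean is at most [C / (n + 1)]. The uniform bound is the working notion because
    it survives shifts and summable perturbations by merely enlarging the constant. *)
Lemma bounded_discrepancy_mean {R : realType} (u : nat -> R) (mu : R) :
  bounded_discrepancy u mu -> arithmetic_mean u @ \oo --> mu.
Proof.
move=> [C hC]; apply/cvgrPdist_le => e e0.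
have C0 : 0 <= C by apply: le_trans (hC 0%N).
near=> n.
have n0 : 0 < n.+1%:R :> R by rewrite ltr0n.
have -> : mu - arithmetic_mean u n = - (n.+1%:R^-1 * \sum_(k < n.+1) (u k - mu)).
  rewrite /arithmetic_mean /series /= big_mkord sumrB sumr_const card_ord.
  by rewrite -[mu *+ _]mulr_natl mulrBr mulKf ?gt_eqF// opprB.
rewrite normrN normrM normfV (gtr0_norm n0) ler_pdivrMl// (le_trans (hC _))//.
rewrite mulrC -ler_pdivrMl// (@le_trans _ _ n%:R)//; last by rewrite ler_nat.
rewrite mulrC; near: n; exact: nbhs_infty_ger.
Unshelve. all: by end_near. Qed.

Lemma bounded_discrepancy_shift {R : realType} (u : nat -> R) (mu : R) K :
  bounded_discrepancy (fun k => u (k + K)%N) mu -> bounded_discrepancy u mu.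
Proof.
move=> [C hC]; exists (\sum_(k < K) `|u k - mu| + C) => N.
have C0 : 0 <= C by apply: le_trans (hC 0%N).
have [NK|KN] := leqP N K.
  rewrite (le_trans (ler_norm_sum _ _ _))//.
  rewrite -(subnKC NK) big_split_ord /= -addrA lerDl addr_ge0//.
  exact: sumr_ge0.
rewrite -(subnKC (ltnW KN)) big_split_ord /= (le_trans (ler_normD _ _))//.
apply: lerD; first exact: ler_norm_sum.
by under eq_bigr do rewrite addnC; exact: hC.
Qed.

(** The centred sum over a full period vanishes, so only the last [N %% L] terms count. *)
Lemma bounded_discrepancy_periodic {R : realType} (v : nat -> R) L :
  (0 < L)%N -> (forall k, v (L + k)%N = v k) ->
  bounded_discrepancy v (L%:R^-1 * \sum_(k < L) v k).
Proof.
move=> L0 hv; set mu := (X in bounded_discrepancy _ X).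
have S0 : \sum_(k < L) (v k - mu) = 0.
  rewrite sumrB sumr_const card_ord -[mu *+ _]mulr_natl mulVKf ?subrr//.
  by rewrite pnatr_eq0 -lt0n.
have SE q N : \sum_(k < q * L + N) (v k - mu) = \sum_(k < N) (v k - mu).
  elim: q => [//|q IHq]; rewrite mulSn -addnA big_split_ord /= S0 add0r.
  by rewrite -IHq; apply: eq_bigr => k _; rewrite hv.
exists (\sum_(k < L) `|v k - mu|) => N.
rewrite (divn_eq N L) SE (le_trans (ler_norm_sum _ _ _))//.
rewrite -[in leRHS](subnKC (ltnW (ltn_pmod N L0))) big_split_ord /= lerDl.
exact: sumr_ge0.
Qed.

Lemma bounded_discrepancy_geometric {R : realType} (u v : nat -> R) (mu c q : R) :
  0 <= q < 1 -> (forall k, `|u k - v k| <= c * q ^+ k) ->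
  bounded_discrepancy v mu -> bounded_discrepancy u mu.
Proof.
move=> /andP[q0 q1] huv [C hC]; exists (c * (1 - q)^-1 + C) => N.
have c0 : 0 <= c by have := huv 0%N; rewrite expr0 mulr1; apply: le_trans.
have -> : \sum_(k < N) (u k - mu) =
    \sum_(k < N) (u k - v k) + \sum_(k < N) (v k - mu).
  by rewrite -big_split; apply: eq_bigr => k _; rewrite /= addrA subrK.
rewrite (le_trans (ler_normD _ _))// lerD//.
rewrite (le_trans (ler_norm_sum _ _ _))//.
rewrite (le_trans (ler_sum _ (fun (k : 'I_N) _ => huv k)))//.
rewrite -mulr_sumr ler_wpM2l// -[leRHS]mul1r ler_pdivlMr ?subr_gt0//.
(* [1 - q] times the geometric sum is [1 - q ^+ N], hence at most 1. *)
rewrite mulrC -opprB mulNr -subrX1 opprB gerBl.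
exact: exprn_ge0.
Qed.

(** Serves to turn a contraction per period into a rate per turn without extracting roots. *)
Lemma bernoulli_ge {R : realType} (t : R) n :
  0 <= t <= 1 -> 1 - n%:R * t <= (1 - t) ^+ n.
Proof.
move=> /andP[t0 t1]; elim: n => [|n IHn]; first by rewrite mul0r subr0.
rewrite exprS; apply: le_trans (_ : (1 - t) * (1 - n%:R * t) <= _); last first.
  by rewrite ler_wpM2l// subr_ge0.
have : 0 <= n%:R * t ^+ 2 by rewrite mulr_ge0 ?ler0n ?exprn_ge0.
by rewrite -natr1; lra.
Qed.

Section Greedy.
Context {R : realType}.
Implicit Types (rho phi : R) (x y z d : 'rV[R]_3).

(** * Action of the games on the simplex and on zero-sum vectors *)

Lemma p0_itv rho : 0 <= p0 rho <= 1.
Proof.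
have h : 0 < 1 + rho ^+ 2 by rewrite ltr_wpDr// sqr_ge0.
by rewrite /p0 divr_ge0 ?sqr_ge0 ?(ltW h)//= ler_pdivrMr// mul1r lerDr.
Qed.

Lemma p1_itv rho : 0 < rho -> 0 <= p1 rho <= 1.
Proof.
move=> r0; have h : 0 < 1 + rho by rewrite addr_gt0.
by rewrite /p1 invr_ge0 (ltW h)/= invf_le1// lerDl ltW.
Qed.

Lemma Delta_mulmx (P : 'M[R]_3) x :
  (forall i j, 0 <= P i j) -> (forall i, \sum_j P i j = 1) ->
  Delta x -> Delta (x *m P).
Proof.
move=> P0 P1 [x0 x1]; split=> [j|].
  by rewrite mxE sumr_ge0// => i _; rewrite mulr_ge0.
under eq_bigr do rewrite mxE.
rewrite exchange_big /= -[RHS]x1; apply: eq_bigr => i _.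
by rewrite -mulr_sumr P1 mulr1.
Qed.

Lemma Delta_convex phi x y : 0 <= phi <= 1 -> Delta x -> Delta y ->
  Delta ((1 - phi) *: x + phi *: y).
Proof.
move=> /andP[f0 f1] [x0 x1] [y0 y1]; split=> [i|].
  by rewrite !mxE addr_ge0 ?mulr_ge0 ?subr_ge0.
under eq_bigr do rewrite !mxE.
by rewrite big_split -!mulr_sumr /= x1 y1 !mulr1 subrK.
Qed.

Lemma Delta_game rho phi g x : 0 < rho -> 0 <= phi <= 1 ->
  Delta x -> Delta (x *m game_mx rho phi g).
Proof.
move=> r0 hphi hx.
have /andP[a0 a1] := p0_itv rho; have /andP[b0 b1] := p1_itv rho r0.
case: g; rewrite /= /PA /PB mulmxDr mul_mx_scalar -scalemxAr;
  apply: Delta_convex => //; apply: Delta_mulmx => //.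
- by move=> [[|[|[|//]]] hi] [[|[|[|//]]] hj]; rewrite mxE /=; lra.
- by move=> [[|[|[|//]]] hi]; rewrite !big_ord_recl big_ord0 !mxE /=; lra.
- by move=> [[|[|[|//]]] hi] [[|[|[|//]]] hj]; rewrite mxE /=; lra.
- by move=> [[|[|[|//]]] hi]; rewrite !big_ord_recl big_ord0 !mxE /=; lra.
Qed.

Lemma Delta_le1 x i : Delta x -> 0 <= x 0 i <= 1.
Proof.
move=> [x0 x1]; rewrite x0 /= -x1 (bigD1 i)//= lerDl.
exact: sumr_ge0.
Qed.

Lemma Delta_trajectory rho phi x k : 0 < rho -> 0 <= phi <= 1 ->
  Delta x -> Delta (trajectory rho phi x k).
Proof.
by move=> r0 hphi hx; elim: k => //= k IHk; exact: Delta_game.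
Qed.

(** [PA0] is half of the all-ones matrix minus the identity, and the all-ones matrix kills [d]; what
    remains is [1 - phi - phi / 2]. *)
Lemma mul_PA_sum0 phi d : \sum_i d 0 i = 0 ->
  d *m PA phi = (1 - 3 / 2 * phi) *: d.
Proof.
rewrite !big_ord_recl big_ord0 => hd; apply/rowP => j.
rewrite /PA mulmxDr mul_mx_scalar -scalemxAr !mxE !big_ord_recl big_ord0 !mxE.
move: hd; rewrite [lift _ _](_ : _ = 1)//; last exact/val_inj.
rewrite [lift _ _](_ : _ = 2%:R)//; last exact/val_inj.
rewrite [ord0](_ : _ = 0)// addr0 => /eqP; rewrite addr_eq0 => /eqP dE.
case: j => -[|[|[|//]]] hj /=.
- by rewrite (_ : Ordinal hj = 0) ?dE; [field|exact/val_inj].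
- by rewrite (_ : Ordinal hj = 1) ?dE; [field|exact/val_inj].
- by rewrite (_ : Ordinal hj = 2%:R) ?dE; [field|exact/val_inj].
Qed.

(** * Profit of game B and its Poisson equation *)

Definition profit_rate rho : R :=
  2 * (1 - rho) * (1 + rho + rho ^+ 2) / ((1 + rho) * (1 + rho ^+ 2)).

Lemma profit_rate_gt0 rho : 0 < rho < 1 -> 0 < profit_rate rho.
Proof.
move=> /andP[r0 r1]; have h : 0 < rho ^+ 2 by rewrite exprn_gt0.
by rewrite /profit_rate divr_gt0 ?mulr_gt0 ?subr_gt0// ?addr_gt0.
Qed.

(** The last two entries of [zeta] agree, so on [Delta] the gain is affine in [x 0 0]. Its slope is
    [- 2 * (p1 - p0)], which is [- profit_rate], and its zero is [pi0]. *)
Lemma mul_zeta rho x : 0 < rho -> Delta x ->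
  (x *m zeta rho) 0 0 = profit_rate rho * (pi0 rho - x 0 0).
Proof.
move=> r0 [_]; rewrite mxE !big_ord_recl !big_ord0 !mxE /= => hx.
set a := x 0 0 in hx *; set b := x 0 _ in hx *; set c := x 0 _ in hx *.
have -> : b = 1 - a - c by lra.
rewrite /profit_rate /pi0 /p0 /p1; field.
have h : 0 < rho ^+ 2 by rewrite exprn_gt0.
by rewrite !gt_eqF//; lra.
Qed.

(** The Poisson equation determines its solution up to an additive constant, fixed here by the value
    0 at the first state. *)
Definition poisson_solution rho : 'cV[R]_3 :=
  \col_i [:: 0; - ((1 - rho) * (2 + rho) / (1 + rho + rho ^+ 2));
                - ((1 - rho) * (1 + 2 * rho) / (1 + rho + rho ^+ 2))]`_i.

Lemma poisson_solutionP rho : 0 < rho ->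
  PB0 rho *m poisson_solution rho - poisson_solution rho = zeta rho.
Proof.
move=> r0; have h : 0 < rho ^+ 2 by rewrite exprn_gt0.
apply/colP => -[[|[|[|//]]] hi];
  rewrite !mxE !big_ord_recl big_ord0 !mxE /= /p0 /p1; field;
  by rewrite !gt_eqF//; lra.
Qed.

(** Since [PB - 1 = phi * (PB0 - 1)], the profit of a turn of B is the increment of the potential
    [x *m poisson_solution rho]. *)
Lemma mul_PB_poisson rho phi x : 0 < rho ->
  phi * (x *m zeta rho) 0 0 =
  (x *m PB rho phi *m poisson_solution rho) 0 0 - (x *m poisson_solution rho) 0 0.
Proof.
move=> r0.
have -> : x *m PB rho phi = (1 - phi) *: x + phi *: (x *m PB0 rho).
  by rewrite /PB mulmxDr mul_mx_scalar -scalemxAr.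
rewrite -(poisson_solutionP _ r0).
rewrite mulmxDl -!scalemxAl mulmxBr mulmxA.
move: (x *m PB0 rho *m _) (x *m _) => u v; rewrite !mxE; ring.
Qed.

Lemma mulmx_col_bounded (h : 'cV[R]_3) x : Delta x ->
  `|(x *m h) 0 0| <= \sum_i `|h i 0|.
Proof.
move=> hx; rewrite mxE (le_trans (ler_norm_sum _ _ _))// ler_sum// => i _.
have /andP[x0 x1] := Delta_le1 _ i hx.
by rewrite normrM ger0_norm// ler_piMl.
Qed.

Lemma game_played_DeltaB rho x : DeltaB rho x -> game_played rho x = GameB.
Proof. by move=> [_ hx]; rewrite /game_played memNset. Qed.

Lemma game_playedB_lt rho x : Delta x -> game_played rho x = GameB ->
  x 0 0 < pi0 rho.
Proof.
rewrite /game_played => hx; case: ifPn => // /negP hA _.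
by rewrite ltNge; apply/negP => h; apply: hA; rewrite inE; split.
Qed.

Lemma profit_gt0 rho phi x : 0 < rho < 1 -> 0 < phi -> Delta x ->
  game_played rho x = GameB -> 0 < profit rho phi x.
Proof.
move=> hrho f0 hx E; have /andP[r0 _] := hrho; rewrite /profit E.
rewrite mul_zeta//; apply/mulr_gt0/mulr_gt0 => //; first exact: profit_rate_gt0.
by rewrite subr_gt0 game_playedB_lt.
Qed.

Lemma profit_ge0 rho phi x : 0 < rho < 1 -> 0 < phi -> Delta x ->
  0 <= profit rho phi x.
Proof.
move=> hrho f0 hx; case E: (game_played rho x); first by rewrite /profit E.
by rewrite ltW// profit_gt0.
Qed.

(** * Long-run profit along trajectories *)

Lemma trajectoryD rho phi x m k :
  trajectory rho phi x (m + k) = trajectory rho phi (trajectory rho phi x k) m.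
Proof. exact: iterD. Qed.

Lemma B_forever_discrepancy rho phi x : 0 < rho -> 0 <= phi <= 1 -> Delta x ->
  B_eventually_forever rho phi x ->
  bounded_discrepancy (fun k => profit rho phi (trajectory rho phi x k)) 0.
Proof.
move=> r0 hphi hx [K _ hK]; apply: (@bounded_discrepancy_shift _ _ _ K).
pose h := poisson_solution rho.
pose t k := (trajectory rho phi x (k + K) *m h) 0 0.
exists (\sum_i `|h i 0| + \sum_i `|h i 0|) => N.
have -> : \sum_(k < N) (profit rho phi (trajectory rho phi x (k + K)) - 0) =
    t N - t 0%N.
  rewrite -telescope_sumr// big_mkord; apply: eq_bigr => k _; rewrite subr0.
  have hB := game_played_DeltaB _ _ (hK _ (leq_addl k K)).
  by rewrite /profit /t addSn /= hB mul_PB_poisson// /F hB.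
by rewrite (le_trans (ler_normB _ _))// lerD// mulmx_col_bounded//;
  exact: Delta_trajectory.
Qed.

(** Writing the difference as a scalar times [z - z'] with both points in [Delta] avoids any norm
    estimate for [PB]: a turn of B moves [z] and [z'] inside the simplex, a turn of A only
    multiplies the scalar. *)
Lemma trajectory_diff rho phi x y (g : nat -> game) k :
  0 < rho -> 0 <= phi <= 1 -> Delta x -> Delta y ->
  (forall j, game_played rho (trajectory rho phi x j) = g j) ->
  (forall j, game_played rho (trajectory rho phi y j) = g j) ->
  exists z z', [/\ Delta z, Delta z' &
    trajectory rho phi x k - trajectory rho phi y k =
    (1 - 3 / 2 * phi) ^+ (\sum_(j < k) (if g j is GameA then 1 else 0)%N) *:
      (z - z')].
Proof.
move=> r0 hphi hx hy gx gy.
elim: k => [|k [z [z' [hz hz' IHk]]]].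
  by exists x, y; split; rewrite // big_ord0 expr0 scale1r.
have hxk := @Delta_trajectory rho phi x k r0 hphi hx.
have hyk := @Delta_trajectory rho phi y k r0 hphi hy.
rewrite big_ord_recr /= /F gx gy -mulmxBl; case: (g k) => /=.
  exists z, z'; split=> //; rewrite mul_PA_sum0.
    by rewrite IHk scalerA -exprS addn1.
  under eq_bigr do rewrite !mxE.
  by rewrite sumrB hxk.2 hyk.2 subrr.
exists (z *m PB rho phi), (z' *m PB rho phi); split.
- exact: (@Delta_game rho phi GameB).
- exact: (@Delta_game rho phi GameB).
- by rewrite addn0 IHk -scalemxAl mulmxBl.
Qed.

(** The count of A grows at each multiple of [size w]. At any other [k] the bound is already strict,
    since equality would make [k] a multiple of [size w], so it leaves room for one more turn. *)
Lemma leq_size_mul_countA (w : seq game) k :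
  let g j := nth GameA w (j %% size w) in
  (0 < size w)%N -> g 0%N = GameA ->
  (k <= size w * \sum_(j < k) (if g j is GameA then 1 else 0))%N.
Proof.
move=> g w0 g0; elim: k => // k IHk; rewrite big_ord_recr /= mulnDr.
have [kw|kw] := boolP (size w %| k)%N.
  have -> : g k = GameA by rewrite /g (eqP kw) -[RHS]g0 /g mod0n.
  by rewrite muln1 -addn1 leq_add.
rewrite (leq_trans _ (leq_addr _ _))// ltn_neqAle IHk andbT.
by apply: contraNneq kw => ->; rewrite dvdn_mulr.
Qed.

Lemma profit_diff_geometric rho phi (w : seq game) :
  0 < rho < 1 -> 0 < phi <= 1 -> (0 < size w)%N -> nth GameA w 0 = GameA ->
  exists c q : R, 0 <= q < 1 /\ forall x y k, Delta x -> Delta y ->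
    plays_periodically rho phi w x -> plays_periodically rho phi w y ->
    `|profit rho phi (trajectory rho phi x k) -
      profit rho phi (trajectory rho phi y k)| <= c * q ^+ k.
Proof.
move=> hrho hphi w0 wA; have /andP[r0 r1] := hrho; have /andP[f0 f1] := hphi.
have hphi' : 0 <= phi <= 1 by rewrite ltW.
have c0 : 0 < phi * profit_rate rho by exact/mulr_gt0/profit_rate_gt0.
pose a := `|1 - 3 / 2 * phi|.
have a1 : a < 1 by rewrite ltr_norml; lra.
have a0 : 0 <= a by exact: normr_ge0.
have L0 : 0 < (size w)%:R :> R by rewrite ltr0n.
have L1 : 1 <= (size w)%:R :> R by rewrite ler1n.
(* [q] is chosen so that Bernoulli's inequality gives [a <= q ^+ size w]. *)
pose t := (1 - a) / (size w)%:R.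
have t0 : 0 < t by rewrite divr_gt0// subr_gt0.
have t1 : t <= 1 by rewrite ler_pdivrMr// mul1r; lra.
exists (phi * profit_rate rho), (1 - t); split; first by lra.
move=> x y k hx hy gx gy.
have hxk := @Delta_trajectory rho phi x k r0 hphi' hx.
have hyk := @Delta_trajectory rho phi y k r0 hphi' hy.
have q0 : 0 <= 1 - t by lra.
(* Both trajectories play the same game at turn [k]; for A both profits are 0, for B they differ by
   [c] times the difference of the first coordinates. *)
rewrite /profit gx gy; case: nth.
  by rewrite subrr normr0 mulr_ge0 ?exprn_ge0// ltW.
rewrite !mul_zeta// -!mulrBr mulrA normrM gtr0_norm// ler_pM2l//.
rewrite opprB addrC addrA subrK distrC.
have [z [z' [hz hz']]] := @trajectory_diff rho phi x y _ k r0 hphi' hx hy gx gy.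
set m := (\sum_(j < k) _)%N => /rowP/(_ 0); rewrite !mxE => hd.
rewrite hd normrM normrX -/a.
apply: (@le_trans _ _ (a ^+ m)).
  rewrite ler_piMr ?exprn_ge0// ler_norml.
  by have := Delta_le1 _ 0 hz; have := Delta_le1 _ 0 hz'; lra.
apply: (@le_trans _ _ ((1 - t) ^+ (size w * m))).
  rewrite exprM lerXn2r ?nnegrE ?exprn_ge0//.
  apply: le_trans (bernoulli_ge t (size w) _); last by rewrite ltW.
  by rewrite /t mulrC divfK ?gt_eqF// opprB addrC subrK.
(* As [1 - t] lies in [0, 1], it remains to see that [k <= size w * m]. *)
rewrite ler_wiXn2l//; first by lra.
by apply: leq_size_mul_countA => //; rewrite mod0n.
Qed.

(** A word beginning with A and B covers both cycle forms. The limit is the mean over one period of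
    the cycle: all terms are nonnegative, and the one at turn 1, where B is played, is positive. *)
Lemma limit_cycle_profit_gt0 rho phi (w : seq game) :
  0 < rho < 1 -> 0 < phi <= 1 ->
  has_limit_cycle rho phi [:: GameA, GameB & w] ->
  exists mu : R, 0 < mu /\
    forall x, Delta x ->
      plays_eventually_periodically rho phi [:: GameA, GameB & w] x ->
      asymptotic_profit rho phi x mu.
Proof.
move=> hrho hphi [y [[hy _] _ yL gy]].
set w' := [:: GameA, GameB & w] in yL gy *.
have /andP[r0 r1] := hrho; have /andP[f0 f1] := hphi.
have hphi' : 0 <= phi <= 1 by rewrite ltW.
pose v k := profit rho phi (trajectory rho phi y k).
have hv k : Delta (trajectory rho phi y k) by exact: Delta_trajectory.
exists ((size w')%:R^-1 * \sum_(k < size w') v k); split.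
  rewrite mulr_gt0 ?invr_gt0 ?ltr0n// !big_ord_recl /=.
  have g1 : game_played rho (trajectory rho phi y 1) = GameB.
    by rewrite gy modn_small.
  rewrite ltr_wpDl ?profit_ge0// ltr_pwDl ?profit_gt0//.
  by apply: sumr_ge0 => i _; exact: profit_ge0.
move=> x hx [K hK]; apply: bounded_discrepancy_mean.
apply: (@bounded_discrepancy_shift _ _ _ K).
have [c [q [hq hcq]]] := profit_diff_geometric rho phi w' hrho hphi isT erefl.
apply: (@bounded_discrepancy_geometric _ _ v _ c q hq).
  by move=> k; rewrite trajectoryD; apply: hcq => //; exact: Delta_trajectory.
by apply: bounded_discrepancy_periodic => // k; rewrite /v addnC trajectoryD yL.
Qed.

End Greedy.

Theorem theorem11 (R : realType) (rho phi : R)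
    (hrho : 0 < rho < 1) (hphi : 0 < phi <= 1) :
  [/\ (* mu_{\bar B} = 0 *)
      forall x : 'rV[R]_3, Delta x -> B_eventually_forever rho phi x ->
        asymptotic_profit rho phi x 0,
      (* mu_{[1,n]} > 0 *)
      forall n : nat, (2 <= n)%N -> ~~ odd n ->
        has_limit_cycle rho phi (word1 n) ->
        exists mu : R, 0 < mu /\
          forall x : 'rV[R]_3, Delta x ->
            plays_eventually_periodically rho phi (word1 n) x ->
            asymptotic_profit rho phi x mu
    & (* mu_{[1,n,1,n-2]} > 0 *)
      forall n : nat, (4 <= n)%N -> ~~ odd n ->
        has_limit_cycle rho phi (word2 n) ->
        exists mu : R, 0 < mu /\
          forall x : 'rV[R]_3, Delta x ->
            plays_eventually_periodically rho phi (word2 n) x ->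
            asymptotic_profit rho phi x mu].
Proof.
split.
- move=> x hx hB; apply: bounded_discrepancy_mean.
  have /andP[r0 _] := hrho; have /andP[f0 f1] := hphi.
  by apply: B_forever_discrepancy => //; rewrite ltW.
(* For a successor the word reduces by computation to one starting with [GameA], [GameB]; the same
   holds for [word2]. *)
- by move=> [//|n] _ _; exact: limit_cycle_profit_gt0.
- by move=> [//|n] _ _; exact: limit_cycle_profit_gt0.
Qed.
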